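(* Let $P$ be a poset with $P\cong P^2$ and let $X$ be a $GO$-space. If for every point $x\in X$ every non-zero cardinal $\kappa\le\chi(x;X)$ is $P$-dominated, then $X$ has a $P$-base. If the $GO$-space $X$ is compact, then the converse also holds: if $X$ has a $P$-base, then for every $x\in X$ every non-zero cardinal $\kappa\le\chi(x;X)$ is $P$-dominated.
   Context: A poset is a non-empty set with a reflexive transitive relation. For posets $P,Q$ write $P\succcurlyeq Q$, and say that $Q$ is $P$-dominated, if there is a monotone map $f:P\to Q$ with cofinal image (for each $q\in Q$ there is $p\in P$ with $q\le f(p)$). $P\cong Q$ means $P\succcurlyeq Q$ and $Q\succcurlyeq P$. $P^2$ has the coordinatewise order; cardinals are posets under their well-order. A topological space $X$ has a $P$-base if at each $x\in X$ there is a neighborhood base $(U_\alpha[x])_{\alpha\in P}$ with $U_\beta[x]\subset U_\alpha[x]$ for all $\alpha\le\beta$ in $P$. $\chi(x;X)$ is the smallest cardinality of a neighborhood base at $x$. A $GO$-space (generalized ordered space) is a topological space $X$ having a base of the topology consisting of order-convex sets with respect to some closed linear order $\le$ on $X$ (closed means closed as a subset of $X\times X$); a set $A$ is order-convex if $x,y\in A$, $x<y$ imply $\{z\in X:x\le z\le y\}\subset A$. *)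

(* Defs.v *)
From mathcomp Require Import all_boot all_order.
From mathcomp Require Import boolp classical_sets functions cardinality wochoice.
From mathcomp Require Import topology.

Set Implicit Arguments.
Unset Strict Implicit.
Unset Printing Implicit Defensive.

Local Open Scope classical_set_scope.
Local Open Scope card_scope.
Local Open Scope order_scope.

(* A "poset" here is a non-empty set with a reflexive transitive relation;
   antisymmetry is not required, hence [preorderType]. Non-emptiness is a
   separate hypothesis where it is needed. *)
Definition dominates d1 (P : preorderType d1) d2 (Q : preorderType d2) : Prop :=
  exists f : P -> Q,
    {homo f : p p' / p <= p'} /\ forall q : Q, exists p : P, q <= f p.

Definition poset_equiv d1 (P : preorderType d1) d2 (Q : preorderType d2) : Prop :=
  dominates P Q /\ dominates Q P.

(* Cardinals are initial ordinals: well-orders that do not inject into any of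
   their proper initial segments. Every cardinal is represented, up to order
   isomorphism, by such a [K]; on these [#<=] is the order of cardinals. *)
Definition is_cardinal d (K : orderType d) : Prop :=
  well_order (<=%O : rel K) /\
  forall k : K, ~ ([set: K] #<= [set j : K | j < k]).

Section Topology.
Variable X : topologicalType.

Definition nbhs_base (x : X) (B : set_system X) : Prop :=
  B `<=` nbhs x /\ forall V, nbhs x V -> exists2 U, B U & U `<=` V.

Definition is_character (x : X) d (chi : orderType d) : Prop :=
  [/\ is_cardinal chi,
      exists2 B, nbhs_base x B & B #= [set: chi] &
      forall B, nbhs_base x B -> [set: chi] #<= B].

Definition has_base_indexed_by d (P : preorderType d) : Prop :=
  forall x : X, exists U : P -> set X,
    nbhs_base x (range U) /\ forall a b : P, a <= b -> U b `<=` U a.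

Definition order_convex (le : rel X) (A : set X) : Prop :=
  forall x y, A x -> A y -> le x y -> x != y ->
    [set z | le x z /\ le z y] `<=` A.

Definition GO_space : Prop :=
  exists le : rel X,
    [/\ [/\ reflexive le, antisymmetric le, transitive le & total le],
        closed [set p : X * X | le p.1 p.2] &
        exists2 B : set_system X, basis B & B `<=` order_convex le].

Definition dominates_cardinals_upto_character d (P : preorderType d) : Prop :=
  forall (x : X) dc (chi : orderType dc), is_character x chi ->
  forall dk (kappa : orderType dk), is_cardinal kappa ->
    [set: kappa] !=set0 -> [set: kappa] #<= [set: chi] -> dominates P kappa.

End Topology.

(* Main.v *)
Require Import Defs.
From HB Require Import structures.
From Stdlib Require Import Wellfounded.
From mathcomp Require Import all_boot all_order.
From mathcomp Require Import boolp classical_sets functions cardinality topology.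
From mathcomp Require Import wochoice.
Set Implicit Arguments.
Unset Strict Implicit.
Unset Printing Implicit Defensive.
Import Order.TTheory.
Local Open Scope order_scope.
Local Open Scope classical_set_scope.
Local Open Scope card_scope.

(** In a GO-space a neighborhood base at [x] splits into two independent
    halves: one family of neighborhoods that shrinks to [x] within the points
    [z <= x], and one that does so within the points [z >= x]
    ([nbhs_base_of_sides]).  A half is generated by a single neighborhood when
    [x] is not a limit from that side ([lower_base_isolated]), and otherwise by
    the open rays at the points of any set cofinal in [{y | y < x}]
    ([lower_base_rays]).  Only the side below is ever treated; the side above
    is the same statement for the reversed order.

    From cardinals to a P-base.  If [x] is a limit from below, let [kappa] be
    the least cardinality of a set cofinal below [x].  Every neighborhood base
    at [x] yields a cofinal set of no larger size, so [kappa <= chi(x;X)] and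
    there is a monotone cofinal map [P -> kappa].  Minimality of [kappa] makes
    a cofinal set of size [kappa] improvable to an increasing cofinal family
    [y : kappa -> X] ([increasing_transversal]); the composite indexes the
    rays by [P].  Both halves together are indexed by [P * P], hence by [P].

    From a P-base to cardinals, [X] compact.  A cardinal [kappa] with a
    greatest element is dominated by a constant map, so let [kappa] have none.
    It is enough to find any increasing family [y : kappa -> X]: by
    compactness it converges to a point [x'], which need not be [x], and the
    P-base [U] at [x'] gives the monotone map that sends [p] to the least [k]
    with all later [y j] in [U p]; this map is cofinal because each [y k] lies
    strictly below [x'] and so is missed by some [U p]
    ([dominates_of_increasing_family]).  Such a family exists below [x] by
    transfinite recursion as soon as every set cofinal below [x] has at least
    [kappa] elements.  If this fails on both sides of
    [x], then both halves of a base at [x] have fewer than [kappa] members,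
    and, as [kappa] is infinite, so has the resulting base, which contradicts
    [kappa <= chi(x;X)].  This last step is the equality of an infinite
    cardinal with its square ([card_setXX_infinite]).

    The comparisons of cardinals rest on one use of transfinite recursion: a
    well-ordered set none of whose proper initial segments has at least the
    size of [B] injects into [B] ([card_le_of_segments]). *)

(** * Injections and surjections between sets *)

Lemma card_le_inj T U (A : set T) (B : set U) (f : T -> U) :
  (forall x, A x -> B (f x)) ->
  (forall x y, A x -> A y -> f x = f y -> x = y) -> A #<= B.
Proof.
move=> fAB f_inj; have [g] : $|{injfun A >-> B}|.
  apply/injfunPex; exists f => // x y.
  by rewrite !inE; exact: f_inj.
exact: inj_card_le g.
Qed.

Lemma card_le_ex_inj T U (A : set T) (B : set U) : A !=set0 -> A #<= B ->
  exists f : T -> U, (forall x, A x -> B (f x)) /\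
    forall x y, A x -> A y -> f x = f y -> x = y.
Proof.
move=> [a Aa]; elim/Ppointed: U => U in B *.
  by rewrite card_le_emptyr => /eqP A0; rewrite A0 in Aa.
move=> /pcard_leP/injfunPex[f fAB f_inj]; exists f; split=> // x y Ax Ay.
by apply: f_inj; rewrite inE.
Qed.

Lemma card_le_ex_surj T U (A : set T) (B : set U) : A !=set0 -> A #<= B ->
  exists g : U -> T, (forall u, A (g u)) /\
    forall a, A a -> exists2 u, B u & g u = a.
Proof.
elim/Pchoice: T => T in A * => A0 AB.
have [f [fB f_inj]] := card_le_ex_inj A0 AB.
have [a0 Aa0] := A0; pose fib u := [set a | A a /\ f a = u].
exists (fun u =>
  if pselect (fib u !=set0) is left _ then xget a0 (fib u) else a0).
split=> [u|a Aa]; first by case: pselect => // fu; have [] := xgetPex a0 fu.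
exists (f a); first exact: fB.
case: pselect => [fu|[]]; last by exists a.
by have [? /f_inj] := xgetPex a0 fu; apply.
Qed.

Lemma card_le_setX T T' U U' (A : set T) (A' : set T') (B : set U)
  (B' : set U') : A #<= A' -> B #<= B' -> A `*` B #<= A' `*` B'.
Proof.
move=> AA' BB'; have [->|/set0P[[a b] [/= Aa Bb]]] := eqVneq (A `*` B) set0.
  exact: card_ge0.
have [|f [fA f_inj]] := card_le_ex_inj _ AA'; first by exists a.
have [|g [gB g_inj]] := card_le_ex_inj _ BB'; first by exists b.
apply: (@card_le_inj _ _ _ _ (fun p => (f p.1, g p.2))).
  by move=> p [Ap Bp]; split; [exact: fA|exact: gB].
move=> [x y] [x' y'] [/= Ax By] [/= Ax' By'] [ff gg].
by rewrite (f_inj x x') // (g_inj y y').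
Qed.

(** Hilbert's hotel along an injective sequence in [A]. *)
Lemma card_setU1_infinite T (A : set T) (a : T) :
  infinite_set A -> a |` A #<= A.
Proof.
move=> /infiniteP natA.
have [|f [fA f_inj]] := card_le_ex_inj _ natA; first by exists 0%N.
have [Aa|nAa] := pselect (A a).
  by apply: subset_card_le => x [->|].
(* The new point takes the place of [f 0], each [f n] moves to [f n.+1]. *)
pose shift x y := (x = a /\ y = f 0%N) \/
  (exists2 n, x = f n & y = f n.+1) \/
  [/\ x <> a, ~ (exists n, x = f n) & y = x].
have /choice[g gP] : forall x, exists y, shift x y.
  move=> x; have [->|xa] := pselect (x = a); first by exists (f 0%N); left.
  have [[n ->]|xf] := pselect (exists n, x = f n).
    by exists (f n.+1); right; left; exists n.
  by exists x; right; right.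
have fneqa n : f n <> a by move=> fna; apply: nAa; rewrite -fna; exact: fA.
have f_eq m n : f m = f n -> m = n by exact: f_inj.
apply: (@card_le_inj _ _ _ _ g) => [x xaA|x y _ _].
  case: (gP x) => [[_ ->]|[[n _ ->]|[xa _ ->]]]; [exact: fA|exact: fA|].
  by case: xaA.
case: (gP x) => [[-> ->]|[[n -> ->]|[xa xf ->]]];
  case: (gP y) => [[-> ->]|[[m -> ->]|[ya yf ->]]] => //.
- by move=> /f_eq.
- by move=> e; case: yf; exists 0%N.
- by move=> /f_eq.
- by move=> /f_eq[->].
- by move=> e; case: yf; exists n.+1.
- by move=> e; case: xf; exists 0%N.
- by move=> e; case: xf; exists m.+1.
Qed.

(** * Transfinite recursion and comparison of cardinals *)

(** The value at [w] may depend only on the set of earlier values, and not on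
    how they are indexed; this is enough for greedy choices. *)
Lemma transfinite_recursion (W : Type) (lt : W -> W -> Prop) (T : Type)
    (next : W -> set T -> T) : well_founded lt ->
  exists y : W -> T, forall w, y w = next w (y @` [set v | lt v w]).
Proof.
move=> lt_wf; pose F w (rec : forall v, lt v w -> T) :=
  next w [set t | exists v (vw : lt v w), rec v vw = t].
exists (Fix lt_wf (fun=> T) F) => w; rewrite Fix_eq.
  congr next; apply/seteqP; split=> [t [v [vw <-]]|t [v vw <-]].
    by exists v.
  by exists v, vw.
move=> {}w f g fg; congr F; apply: functional_extensionality_dep => v.
by apply: functional_extensionality_dep => vw; exact: fg.
Qed.

(** Send each [w] of [S] to some element of [B] not used before.  The choice
    never gets stuck: if the earlier values exhausted [B], then [B] would be
    no larger than the segment of [S] below [w]. *)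
Lemma card_le_of_segments (W : Type) (lt : W -> W -> Prop) (S : set W)
    U (B : set U) :
  well_founded lt -> (forall v w, [\/ lt v w, v = w | lt w v]) ->
  (forall w, S w -> ~ (B #<= [set v | S v /\ lt v w])) -> S #<= B.
Proof.
move=> lt_wf lt_tri; elim/Pchoice: U => U in B * => noB.
have [->|/set0P[w0 Sw0]] := eqVneq S set0; first exact: card_ge0.
have [B0|/set0P[b0 Bb0]] := eqVneq B set0.
  by case: (noB _ Sw0); rewrite B0; exact: card_ge0.
have ltS_wf : well_founded (fun v w => S v /\ lt v w).
  by apply: wf_incl lt_wf => v w [].
have [y yE] := @transfinite_recursion W _ U
  (fun _ A => xget b0 (B `\` A)) ltS_wf.
have yP w : S w -> B (y w) /\ forall v, S v -> lt v w -> y v <> y w.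
  move=> Sw; have /(xgetPex b0) :
      exists u, (B `\` y @` [set v | S v /\ lt v w]) u.
    apply: contrapT => noy; apply: (noB _ Sw).
    apply: (card_le_trans _ (card_image_le y _)); apply: subset_card_le => b Bb.
    by apply: contrapT => nyb; apply: noy; exists b.
  rewrite -yE => -[Byw nyw]; split=> // v Sv vw yvw.
  by apply: nyw; exists v.
apply: (@card_le_inj _ _ _ _ y) => [w /yP[]//|v w Sv Sw yvw].
case: (lt_tri v w) => // [vw|wv].
  by case: (yP _ Sw) => _ /(_ _ Sv vw).
by case: (yP _ Sv) => _ /(_ _ Sw wv); rewrite yvw.
Qed.

Lemma wf_least (W : Type) (lt : W -> W -> Prop) (S : set W) :
  well_founded lt -> S !=set0 -> exists2 k, S k & forall j, S j -> ~ lt j k.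
Proof.
move=> lt_wf [s Ss]; apply: contrapT => noleast.
suff noS k : ~ S k by exact: noS Ss.
elim/(well_founded_ind lt_wf): k => k IH Sk.
apply: noleast; exists k => // j Sj jk.
exact: IH jk Sj.
Qed.

(** The well-foundedness used for all minimality arguments on cardinals: [S]
    is [A] itself or its shortest proper initial segment with property [Q]. *)
Lemma least_segment (W : Type) (lt : W -> W -> Prop) (Q : set W -> Prop)
    (A : set W) :
  well_founded lt -> (forall x y z, lt x y -> lt y z -> lt x z) -> Q A ->
  exists S, [/\ S `<=` A, Q S & forall k, S k -> ~ Q (S `&` [set j | lt j k])].
Proof.
move=> lt_wf lt_trans QA; pose cut k := A `&` [set j | lt j k].
have [[k1 Ak1 Qk1]|noQ] := pselect (exists2 k, A k & Q (cut k)); last first.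
  by exists A; split=> // k Ak Qk; apply: noQ; exists k.
have [|k [Ak Qk] k_le] := @wf_least _ _ [set k | A k /\ Q (cut k)] lt_wf.
  by exists k1.
exists (cut k); split=> [j []//|//|j [Aj jk]]; rewrite -setIA.
rewrite (_ : [set j | lt j k] `&` _ = [set i | lt i j]) => [Qj|].
  exact: k_le (conj Aj Qj) jk.
by apply/seteqP; split=> i /= => [[]//|ij]; split=> //; exact: lt_trans jk.
Qed.

Lemma well_order_wf d (K : orderType d) : well_order (<=%O : rel K) ->
  well_founded (fun j k : K => j < k).
Proof.
move=> wo k0; apply: contrapT => nacc.
have [|k [[]]] := wo [pred k | `[< ~ Acc (fun j k : K => j < k) k >]].
  by exists k0; apply/asboolP.
move=> /asboolP naccK k_le _; apply: naccK; constructor => j jk.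
apply: contrapT => naccj; have := k_le j; rewrite leNgt jk => /(_ _)/negP[] //.
exact/asboolP.
Qed.

Lemma lt_tricho d (K : orderType d) (j k : K) : [\/ j < k, j = k | k < j].
Proof. by case: (ltgtP j k) => ?; [apply: Or31|apply: Or33|apply: Or32]. Qed.

(** * Cardinals as ordered types *)

Section OrderTypeOfWellOrder.
Variables (T : choiceType) (R : rel T).
Hypothesis woR : well_order R.

Let woRT : {in <= T, well_order R}. Proof. exact: withinW woR. Qed.

Let R_total : total R. Proof. by move=> x y; exact: (wo_chainW woRT). Qed.

Let R_refl : reflexive R.
Proof. by move=> x; exact: (wo_chain_reflexive woRT). Qed.

Let R_anti : antisymmetric R.
Proof. by move=> x y; exact: (wo_chain_antisymmetric woRT). Qed.

Let R_trans : transitive R.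
Proof.
move=> y x z Rxy Ryz; have [|m [[]]] := woR (A := pred3 x y z).
  by exists x; rewrite !inE eqxx.
rewrite inE => /or3P[/eqP ->|/eqP ->|/eqP ->] m_le _.
- by apply: m_le; rewrite !inE eqxx !orbT.
- suff -> : x = y by [].
  by apply: R_anti; rewrite Rxy m_le // !inE eqxx.
- suff <- : y = z by [].
  by apply: R_anti; rewrite Ryz m_le // !inE eqxx orbT.
Qed.

(** The proof of well-ordering is an argument so that the order structure can
    be attached to the alias, whatever orders [T] itself carries. *)
Definition ordered_by of well_order R : Type := T.

HB.instance Definition _ := Choice.on (ordered_by woR).
HB.instance Definition _ := Order.Le_isPOrder.Build (Order.Disp tt tt)
  (ordered_by woR) R_refl R_anti R_trans.
HB.instance Definition _ := Order.POrder_isTotal.Build (Order.Disp tt tt)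
  (ordered_by woR) R_total.

Lemma orderType_of_well_order :
  exists (K : orderType (Order.Disp tt tt)) (f : K -> T),
    [/\ well_order (<=%O : rel K), bijective f &
        forall x y, (x <= y) = R (f x) (f y)].
Proof. by exists (ordered_by woR), id; split=> //; exists id. Qed.

End OrderTypeOfWellOrder.

Lemma strict_well_order (T : Type) : exists lt : T -> T -> Prop,
  [/\ well_founded lt, forall x y, [\/ lt x y, x = y | lt y x] &
      forall x y z, lt x y -> lt y z -> lt x z].
Proof.
have [R woR] := well_ordering_principle {classic T}.
exists (fun x y => (x : ordered_by woR) < y); split.
- exact: (@well_order_wf _ (ordered_by woR)).
- exact: (@lt_tricho _ (ordered_by woR)).
- by move=> x y z; exact: (@lt_trans _ (ordered_by woR)).
Qed.

(** Well-order [T]: either some segment of [A] is already as large as [B], or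
    the greedy injection of [A] into [B] exists. *)
Lemma card_le_total T U (A : set T) (B : set U) : A #<= B \/ B #<= A.
Proof.
have [lt [lt_wf lt_tri _]] := strict_well_order T.
have [[w Aw Bw]|noB] :=
  pselect (exists2 w, A w & B #<= [set v | A v /\ lt v w]).
  by right; apply: card_le_trans Bw _; apply: subset_card_le => v [].
left; apply: card_le_of_segments lt_wf lt_tri _ => w Aw Bw.
by apply: noB; exists w.
Qed.

(** Take the shortest initial segment of a member of [F] that is as large as
    some member [A] of [F].  No proper segment of it is as large as a member,
    so it injects into all members, and so does [A]. *)
Lemma card_min_ex T (F : set (set T)) : F !=set0 ->
  exists2 A, F A & forall B, F B -> A #<= B.
Proof.
move=> [A0 FA0]; have [lt [lt_wf lt_tri lt_trans]] := strict_well_order T.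
have [|S [_ [A FA AS] noQ]] := @least_segment _ _
    (fun S => exists2 A, F A & A #<= S) A0 lt_wf lt_trans.
  by exists A0 => //; exact: card_lexx.
exists A => // B FB; apply: card_le_trans AS _.
apply: card_le_of_segments lt_wf lt_tri _ => w Sw Bw.
by apply: (noQ w Sw); exists B.
Qed.

(** The shortest initial segment of [A] of the same size as [A], for any
    well-order, is an initial ordinal. *)
Lemma cardinal_ex T (A : set T) :
  exists K : orderType (Order.Disp tt tt), is_cardinal K /\ [set: K] #= A.
Proof.
have [R woR] := well_ordering_principle {classic T}.
pose W := ordered_by woR.
have lt_wf : well_founded (fun x y : W => x < y).
  exact: (@well_order_wf _ W).
have [||S [SA AS noS]] := @least_segment W _ (fun S => A #<= S) A lt_wf.
- by move=> x y z; exact: lt_trans.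
- exact: card_lexx.
pose V := set_type (S : set {classic T}).
have woV : well_order (relpre val R : rel V).
  apply: antisymmetric_well_order.
    by move=> x y /(@le_anti _ W)/val_inj.
  move=> B [b Bb]; have [|z [[zB z_le] _]] :=
      woR [pred t | `[< exists2 c : V, c \in B & val c = t >]].
    by exists (val b); apply/asboolP; exists b.
  move: zB => /asboolP[c cB cz]; exists c; split=> // e Be /=.
  by rewrite cz; apply: z_le; apply/asboolP; exists e.
have [K [f [woK [g fK gK] fR]]] := orderType_of_well_order woV.
have valf_inj j k : val (f j) = val (f k) -> j = k.
  by move=> /val_inj; exact: can_inj fK _ _.
have KS : [set: K] #<= S.
  apply: (@card_le_inj _ _ _ _ (fun k => val (f k))) => [k _|j k _ _].
    exact: set_valP.
  exact: valf_inj.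
have SK : S #<= [set: K].
  apply: card_le_trans (_ : val @` (f @` [set: K]) #<= _).
    apply: subset_card_le => s Ss; exists (exist _ s (mem_set Ss)) => //.
    by exists (g (exist _ s (mem_set Ss))).
  by apply: card_le_trans (card_image_le _ _) (card_image_le _ _).
exists K; split; last first.
  apply: Cantor_Bernstein; last exact: card_le_trans SK.
  exact: card_le_trans KS (subset_card_le SA).
split=> // k Kk; apply: (noS (val (f k))); first exact: set_valP.
apply: card_le_trans (card_le_trans AS SK) _; apply: card_le_trans Kk _.
apply: (@card_le_inj _ _ _ _ (fun k => val (f k))) => [j|i j _ _ /valf_inj//].
rewrite /= lt_def fR => /andP[kj Rjk]; split; first exact: set_valP.
rewrite lt_def; apply/andP; split=> //.
by apply: contra_neq kj => /valf_inj.
Qed.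

(** * Squares of infinite cardinals *)

Lemma wf_irreflexive (W : Type) (lt : W -> W -> Prop) :
  well_founded lt -> forall x, ~ lt x x.
Proof.
move=> lt_wf x; elim/(well_founded_ind lt_wf): x => x IH xx.
exact: (IH x xx xx).
Qed.

Section Lexicographic.
Variables (A B : Type) (ltA : A -> A -> Prop) (ltB : B -> B -> Prop).

Definition lex (p q : A * B) := ltA p.1 q.1 \/ (p.1 = q.1 /\ ltB p.2 q.2).

Lemma lex_wf : well_founded ltA -> well_founded ltB -> well_founded lex.
Proof.
move=> wfA wfB [a b]; elim/(well_founded_ind wfA): a b => a IHa.
elim/(well_founded_ind wfB) => b IHb.
constructor => -[a' b'] [/= a'a|[/= -> b'b]].
  exact: IHa.
exact: IHb.
Qed.

Lemma lex_tricho : (forall x y, [\/ ltA x y, x = y | ltA y x]) ->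
  (forall x y, [\/ ltB x y, x = y | ltB y x]) ->
  forall p q, [\/ lex p q, p = q | lex q p].
Proof.
move=> triA triB [a b] [a' b']; rewrite /lex /=.
case: (triA a a') => [?|->|?]; [by apply: Or31; left| |by apply: Or33; left].
case: (triB b b') => [?|->|?]; [|exact: Or32|]; first by apply: Or31; right.
by apply: Or33; right.
Qed.

End Lexicographic.

(** If [A] is a counterexample, its shortest initial segment [S] that still is
    one is larger than each of its proper segments, and so has no greatest
    element.  Order pairs by their maximum first: then each segment of [S * S]
    lies in the square of a proper segment of [S], which is finite or no
    larger than its side, hence smaller than [S].  So [S * S] injects into
    [S]. *)
Theorem card_setXX_infinite T (A : set T) : infinite_set A -> A `*` A #<= A.
Proof.
move=> Ainf; apply: contrapT => Abad.
have [lt [lt_wf lt_tri lt_trans]] := strict_well_order T.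
have [|S [_ [Sinf Sbad] noS]] := @least_segment _ _
    (fun S => infinite_set S /\ ~ (S `*` S #<= S)) A lt_wf lt_trans.
  by [].
pose seg k := S `&` [set j | lt j k].
have segXX k : S k -> infinite_set (seg k) -> seg k `*` seg k #<= seg k.
  by move=> Sk segk; apply: contrapT => bad; apply: (noS k).
have Sseg k : S k -> ~ (S #<= seg k).
  move=> Sk Sk_le; apply: Sbad.
  apply: card_le_trans (card_le_setX Sk_le Sk_le) _.
  apply: card_le_trans (segXX k Sk _) _.
    by apply: contra_not Sinf => /(card_le_finite Sk_le).
  by apply: subset_card_le => j [].
have Snomax k : S k -> exists2 k', S k' & lt k k'.
  move=> Sk; apply: contrapT => kmax; apply: (Sseg k Sk).
  have Sk_sub : S `<=` k |` seg k.
    move=> j Sj; case: (lt_tri j k) => [jk|->|kj]; [by right|by left|].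
    by case: kmax; exists j.
  apply: card_le_trans (subset_card_le Sk_sub) _.
  apply: card_setU1_infinite => segfin; apply: Sinf.
  by apply: sub_finite_set Sk_sub _; rewrite finite_setU; split.
have irr := wf_irreflexive lt_wf.
have /choice[mx mxP] : forall p : T * T, exists m,
    [/\ (m = p.1 \/ m = p.2), ~ lt m p.1 & ~ lt m p.2].
  move=> [a b] /=; case: (lt_tri a b) => [ab|->|ba].
  - by exists b; split; [right|move=> /(lt_trans _ _ _ ab)/irr|exact: irr].
  - by exists b; split; [right|exact: irr|exact: irr].
  - by exists a; split; [left|exact: irr|move=> /(lt_trans _ _ _ ba)/irr].
pose goedel p q := lex lt (lex lt lt) (mx p, p) (mx q, q).
have goedel_wf : well_founded goedel.
  exact (wf_inverse_image _ _ _ (fun p => (mx p, p))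
    (lex_wf lt_wf (lex_wf lt_wf lt_wf))).
have goedel_tri p q : [\/ goedel p q, p = q | goedel q p].
  have := lex_tricho lt_tri (lex_tricho lt_tri lt_tri) (mx p, p) (mx q, q).
  by case=> [?|[_ ->]|?]; [apply: Or31|apply: Or32|apply: Or33].
apply: Sbad; apply: card_le_of_segments goedel_wf goedel_tri _.
move=> q [Sq1 Sq2] Sq.
have Smx : S (mx q) by case: (mxP q) => -[->|->].
(* Strict segments do not contain their end, so a bound beyond the maximum of
   the pair [q] is taken. *)
have [m Sm mxm] := Snomax _ Smx.
have lt_m k : ~ lt (mx q) k -> lt k m.
  by case: (lt_tri k (mx q)) => [/lt_trans/(_ mxm)//|->//|].
have {}Sq : S #<= seg m `*` seg m.
  apply: card_le_trans Sq _; apply: subset_card_le => p [[Sp1 Sp2] pq].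
  have mxpq : ~ lt (mx q) (mx p).
    move=> qp; case: pq => /= [pq|[pq _]].
      exact: irr (lt_trans _ _ _ qp pq).
    by rewrite pq in qp; exact: irr qp.
  have lt_pm k : ~ lt (mx p) k -> lt k m.
    case: (lt_tri k (mx p)) => [kp _|-> _|//]; last exact: lt_m.
    by apply: lt_trans kp _; exact: lt_m.
  by have [_ p1 p2] := mxP p; split; split=> //=; exact: lt_pm.
have [segfin|seginf] := pselect (finite_set (seg m)).
  by apply: Sinf; apply: card_le_finite Sq _; exact: finite_setX.
exact: Sseg Sm (card_le_trans Sq (segXX m Sm seginf)).
Qed.

Lemma card_setX_infinite K T U (D : set K) (A : set T) (B : set U) :
  infinite_set D -> D #<= A `*` B -> D #<= A \/ D #<= B.
Proof.
move=> Dinf.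
have square V (C : set V) : D #<= C `*` C -> D #<= C.
  move=> DC; have [Cfin|Cinf] := pselect (finite_set C).
    by case: Dinf; apply: card_le_finite DC _; exact: finite_setX.
  exact: card_le_trans DC (card_setXX_infinite Cinf).
move=> DAB; have [AB|BA] := card_le_total A B.
  right; apply: square.
  exact: card_le_trans DAB (card_le_setX AB (card_lexx _)).
left; apply: square.
exact: card_le_trans DAB (card_le_setX (card_lexx _) BA).
Qed.

(** * Increasing families in linear orders *)

Definition linear_order (T : Type) (le : rel T) :=
  [/\ reflexive le, antisymmetric le, transitive le & total le].

Definition reversed (T : Type) (le : rel T) : rel T := fun x y => le y x.

Definition cofinal_in (T : Type) (le : rel T) (L A : set T) :=
  A `<=` L /\ forall l, L l -> exists2 a, A a & le l a.

Lemma linear_order_reversed (T : Type) (le : rel T) :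
  linear_order le -> linear_order (reversed le).
Proof.
move=> [le_refl le_anti le_trans le_total]; split=> //.
- by move=> x y; rewrite andbC; exact: le_anti.
- by move=> y x z yx zy; exact: le_trans zy yx.
- by move=> x y; exact: le_total.
Qed.

Lemma increasing_le (T : Type) (le : rel T) d (K : orderType d) (y : K -> T) :
  linear_order le -> (forall j k, j < k -> ~~ le (y k) (y j)) ->
  forall j k, j <= k -> le (y j) (y k).
Proof.
move=> [le_refl _ _ le_total] y_incr j k.
rewrite le_eqVlt => /predU1P[-> //|/y_incr].
by case/orP: (le_total (y j) (y k)) => [//|->].
Qed.

(** At stage [k] the earlier values form a set of fewer than [K] elements,
    hence not a cofinal one, and some point of [L] exceeds them all; the
    larger of it and [b k] is the next value.  When [b] enumerates a cofinal
    set, so does [y]; a constant [b] serves when only a strictly increasing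
    family is wanted. *)
Lemma increasing_transversal (T : choiceType) (le : rel T) (L : set T)
    d (K : orderType d) (b : K -> T) :
  linear_order le -> is_cardinal K ->
  (forall A, cofinal_in le L A -> [set: K] #<= A) -> (forall k, L (b k)) ->
  exists y : K -> T,
    [/\ forall k, L (y k), forall k, le (b k) (y k) &
        forall j k, j < k -> ~~ le (y k) (y j)].
Proof.
move=> [le_refl le_anti le_trans le_total] [woK Kcard] Kcof Lb.
have lt_wf := well_order_wf woK.
pose above k (A : set T) :=
  [set z | [/\ L z, le (b k) z & forall a, A a -> ~~ le z a]].
have [y yE] := transfinite_recursion (fun k A => xget (b k) (above k A)) lt_wf.
suff yP k : above k (y @` [set j | j < k]) (y k).
  exists y; split=> [k|k|j k jk]; have [? ? yk] := yP k => //.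
  by apply: yk; exists j.
elim/(well_founded_ind lt_wf): k => k IH; rewrite [X in above k _ X]yE.
apply: xgetPex; set A := y @` _.
have [l Ll lA] : exists2 l, L l & forall a, A a -> ~~ le l a.
  apply: contrapT => nol; apply: (Kcard k).
  apply: (card_le_trans _ (card_image_le y _)); apply: Kcof; split.
    by move=> _ [j jk <-]; have [] := IH j jk.
  move=> l Ll; apply: contrapT => noa; apply: nol; exists l => // a Aa.
  by apply/negP => la; apply: noa; exists a.
have [lb|bl] := boolP (le l (b k)).
  exists (b k); split=> // a Aa; apply: contra (lA a Aa); exact: le_trans lb.
exists l; split=> //; case/orP: (le_total (b k) l) => // lb.
by rewrite lb in bl.
Qed.

(** * Neighborhoods in generalized ordered spaces *)

Section GeneralizedOrder.
Variable X : topologicalType.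
Implicit Types (le : rel X) (x : X) (N V : set X).

(** The consequences of closedness of the order and of the convex base that
    are used; in this form they are visibly invariant under reversal. *)
Definition GO_order (le : rel X) :=
  [/\ linear_order le,
      forall y, open [set z | ~~ le z y] /\ open [set z | ~~ le y z] &
      forall (x : X) V, nbhs x V ->
        exists W, [/\ nbhs x W, W `<=` V & order_convex le W]].

Lemma GO_spaceP : GO_space X -> exists le, GO_order le.
Proof.
move=> [le [le_lin le_closed [B [Bopen Bbase] Bconvex]]]; exists le; split=> //.
- move=> y; split.
    rewrite (_ : mkset _ = ~` ((fun z => (z, y)) @^-1` [set p | le p.1 p.2])).
      apply: closed_openC; apply: preimage_closed le_closed => z _.
      by apply: cvg_pair; [exact: cvg_id|exact: cvg_cst].
    by apply/seteqP; split=> z /= /negP.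
  rewrite (_ : mkset _ = ~` ((fun z => (y, z)) @^-1` [set p | le p.1 p.2])).
    apply: closed_openC; apply: preimage_closed le_closed => z _.
    by apply: cvg_pair; [exact: cvg_cst|exact: cvg_id].
  by apply/seteqP; split=> z /= /negP.
move=> x V /Bbase[W [BW Wx] WV]; exists W; split=> //; last exact: Bconvex.
by apply: open_nbhs_nbhs; split=> //; exact: Bopen.
Qed.

Lemma GO_order_reversed le : GO_order le -> GO_order (reversed le).
Proof.
move=> [le_lin rays convex]; split.
- exact: linear_order_reversed.
- by move=> y; have [] := rays y.
move=> x V /convex[W [xW WV Wconvex]]; exists W; split=> // y z Wy Wz zy yz.
by rewrite eq_sym in yz => t [yt tz]; apply: (Wconvex z y).
Qed.

Definition strictly_below (le : rel X) (x : X) := [set y | ~~ le x y].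

Lemma isolated_or_limit_below le x :
  (exists2 N, nbhs x N & N `<=` [set z | le x z]) \/
  (forall N, nbhs x N -> N `&` strictly_below le x !=set0).
Proof.
have [|nlim] := pselect (exists2 N, nbhs x N & N `<=` [set z | le x z]).
  by left.
right=> N xN; apply: contrapT => N0; apply: nlim; exists N => // z Nz.
by apply: contrapT => /negP zx; apply: N0; exists z.
Qed.

(** The members are full neighborhoods of [x], but they are required to be
    small only on the side below [x]. *)
Definition lower_base (le : rel X) (x : X) (A : set_system X) :=
  A `<=` nbhs x /\
  forall V, nbhs x V -> exists2 U, A U & U `&` [set z | le z x] `<=` V.

Lemma nbhs_base_of_sides le x A C : GO_order le ->
  lower_base le x A -> lower_base (reversed le) x C ->
  nbhs_base x [set p.1 `&` p.2 | p in A `*` C].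
Proof.
move=> [[_ _ _ le_total] _ _] [Ax Abase] [Cx Cbase]; split.
  by move=> _ [p [Ap Cp] <-]; apply: filterI; [exact: Ax|exact: Cx].
move=> V xV; have [U AU UV] := Abase V xV; have [W CW WV] := Cbase V xV.
exists (U `&` W); first by exists (U, W).
move=> z [Uz Wz]; case/orP: (le_total z x) => zx; first exact: UV.
exact: WV.
Qed.

Lemma lower_base_isolated le (x : X) N :
  nbhs x N -> N `<=` [set z | le x z] -> antisymmetric le ->
  lower_base le x [set N].
Proof.
move=> xN N_ge le_anti; split=> [_ ->//|V xV]; exists N => // z [/N_ge xz zx].
suff -> : z = x by exact: nbhs_singleton xV.
by apply: le_anti; rewrite xz andbT.
Qed.

Lemma lower_base_rays le x A : GO_order le ->
  (forall N, nbhs x N -> N `&` strictly_below le x !=set0) ->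
  cofinal_in le (strictly_below le x) A ->
  lower_base le x [set [set z | ~~ le z a] | a in A].
Proof.
move=> [[_ le_anti le_trans le_total] rays convex] xlim [A_lt Acof]; split.
  move=> _ [a Aa <-]; apply: open_nbhs_nbhs; split; first by case: (rays a).
  exact: A_lt.
move=> V /convex[W [xW WV Wconvex]]; have [y [Wy yx]] := xlim W xW.
have [a Aa ya] := Acof y yx; exists [set z | ~~ le z a]; first by exists a.
have lt_le s t : ~~ le s t -> le t s.
  by case/orP: (le_total s t) => [->|->].
move=> z [/= za zx]; apply: WV; apply: (Wconvex y x) => //.
- exact: nbhs_singleton xW.
- exact: lt_le.
- by apply: contraNneq yx => <-; case/orP: (le_total y y).
by split=> //; apply: le_trans ya _; exact: lt_le.
Qed.

End GeneralizedOrder.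

(** * Characters and cofinal sets *)

Section PointwiseBases.
Variable X : topologicalType.
Implicit Types (le : rel X) (x : X).

Lemma character_ex x :
  exists chi : orderType (Order.Disp tt tt), is_character x chi.
Proof.
have [|B xB Bmin] := @card_min_ex _ (nbhs_base x).
  by exists (nbhs x); split=> // V xV; exists V.
have [chi [chicard chiB]] := cardinal_ex B; exists chi; split=> //.
  by exists B => //; exact: card_esym.
by move=> C /Bmin; apply: card_le_trans; move/card_eqPle: chiB => [].
Qed.

(** Pick in each member of [B] a point below [x]: these points are cofinal
    below [x], since each ray [{z | l < z}] with [l < x] contains a member. *)
Lemma card_cofinal_le_nbhs_base le x (D : set X) (B : set_system X) :
  GO_order le -> (forall N, nbhs x N -> N `&` strictly_below le x !=set0) ->
  (forall A, cofinal_in le (strictly_below le x) A -> D #<= A) ->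
  nbhs_base x B -> D #<= B.
Proof.
move=> [[_ _ _ le_total] rays _] xlim Dmin [xB Bbase].
have /choice[h hP] : forall U, exists y, B U -> U y /\ strictly_below le x y.
  move=> U; have [BU|nBU] := pselect (B U); last by exists x.
  by have [y []] := xlim U (xB U BU); exists y.
apply: card_le_trans (card_image_le h B); apply: Dmin; split.
  by move=> _ [U BU <-]; have [] := hP U BU.
move=> l lx; have [|U BU Ul] := Bbase [set z | ~~ le z l].
  by apply: open_nbhs_nbhs; split=> //; case: (rays l).
exists (h U); first by exists U.
have [/Ul /= hl _] := hP U BU.
by case/orP: (le_total l (h U)) => // lh; rewrite lh in hl.
Qed.

(** * From dominated cardinals to a P-base *)

(** A least cofinal set below [x] is well-ordered in the type of its
    cardinality [K <= chi(x;X)], and [P] dominates [K]; the rays at the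
    corresponding increasing cofinal family are then indexed by [P]. *)
Lemma indexed_lower_base le x d (P : preorderType d) : GO_order le ->
  [set: P] !=set0 -> dominates_cardinals_upto_character X P ->
  exists U : P -> set X,
    lower_base le x (range U) /\ forall p q, p <= q -> U q `<=` U p.
Proof.
move=> go [p0 _] Pdom; have le_lin : linear_order le by case: go.
have [[le_refl le_anti le_trans le_total] _ _] := go.
have [[N xN N_ge]|xlim] := isolated_or_limit_below le x.
  exists (fun=> N); split; last by move=> p q _ z.
  have -> : range (fun _ : P => N) = [set N].
    by apply/seteqP; split=> [_ [p _ <-]//|_ ->]; exists p0.
  exact: lower_base_isolated.
have [|D [Dx Dcof] Dmin] :=
  @card_min_ex _ (cofinal_in le (strictly_below le x)).
  by exists (strictly_below le x); split=> // l lx; exists l.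
have [K [Kcard KD]] := cardinal_ex D.
have /card_eqPle[KleD DleK] := KD.
have D0 : D !=set0.
  have [y [_ yx]] := xlim _ filterT; have [a Da _] := Dcof y yx; by exists a.
have [b [Db bsurj]] := card_le_ex_surj D0 DleK.
have [chi chix] := character_ex x.
have [f [f_mono f_cof]] : dominates P K.
  apply: (Pdom _ _ _ chix _ _ Kcard).
    have [a Da] := D0; have [k _ _] := bsurj a Da; by exists k.
  have [_ [B xB Bchi] _] := chix; apply: card_le_trans KleD _.
  apply: card_le_trans (card_cofinal_le_nbhs_base go xlim Dmin xB) _.
  by move/card_eqPle: Bchi => [].
have [|||k|y [yx b_le_y y_incr]] :=
  @increasing_transversal _ le (strictly_below le x) _ K b => //.
- by move=> A Acof; apply: card_le_trans KleD (Dmin A Acof).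
- exact: Dx (Db k).
have y_mono := increasing_le le_lin y_incr.
exists (fun p => [set z | ~~ le z (y (f p))]); split; last first.
  move=> p q pq z /=; apply: contra => zp; apply: le_trans zp _.
  exact/y_mono/f_mono.
have := @lower_base_rays _ le x (range (y \o f)) go xlim; rewrite image_comp.
apply; split=> [_ [p _ <-]|l lx]; first exact: yx.
have [a Da la] := Dcof l lx; have [k _ bk] := bsurj a Da.
have [p kp] := f_cof k; exists (y (f p)); first by exists p.
apply: (le_trans _ _ _ la); rewrite -bk; apply: (le_trans _ _ _ (b_le_y k)).
exact: y_mono.
Qed.

(** The two halves are indexed by [P * P], and a monotone cofinal map
    [P -> P * P] reindexes their intersections by [P]. *)
Theorem has_base_of_dominates_cardinals d (P : preorderType d) :
  [set: P] !=set0 -> dominates P (P *p P)%type -> GO_space X ->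
  dominates_cardinals_upto_character X P -> has_base_indexed_by X P.
Proof.
move=> P0 [g [g_mono g_cof]] /GO_spaceP[le go] Pdom x.
have [U [Ubase U_anti]] := indexed_lower_base x go P0 Pdom.
have [V [Vbase V_anti]] := indexed_lower_base x (GO_order_reversed go) P0 Pdom.
have [UVx UVbase] := nbhs_base_of_sides go Ubase Vbase.
exists (fun p => U (g p).1 `&` V (g p).2); split; last first.
  move=> p q /g_mono /andP[gU gV] z [Uz Vz].
  by split; [exact: U_anti Uz|exact: V_anti Vz].
split=> [_ [p _ <-]|W /UVbase[_ [_ [[p1 _ <-] [p2 _ <-]] <-] UVW]].
  by apply: UVx; exists (U (g p).1, V (g p).2).
have [p /andP[p1g p2g]] := g_cof (p1, p2).
exists (U (g p).1 `&` V (g p).2); first by exists p.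
by move=> z [Uz Vz]; apply: UVW; split; [exact: U_anti Uz|exact: V_anti Vz].
Qed.

(** * From a P-base to dominated cardinals *)
Lemma compact_cluster_of_family d (K : orderType d) (y : K -> X) :
  compact [set: X] -> [set: K] !=set0 ->
  exists x, forall N, nbhs x N -> forall k, exists2 j, k <= j & N (y j).
Proof.
move=> cptX [k0 _].
pose tails := filter_from setT (fun k => y @` [set j | k <= j]).
have tails_proper : ProperFilter tails.
  apply: filter_from_proper; last by move=> k _; exists (y k); exists k => /=.
  apply: filter_fromT_filter; first by exists k0.
  move=> i j; exists (Order.max i j) => _ [k /= + <-].
  by rewrite ge_max => /andP[ik jk]; split; exists k.
have [|x [_ xcl]] := cptX tails tails_proper; first exact: filterT.
exists x => N xN k.
have [|z [[j kj <-] Nyj]] := xcl (y @` [set j | k <= j]) N _ xN.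
  by exists k.
by exists j.
Qed.

(** The cluster point [x] of [y] is its supremum, is not attained, and by
    convexity every neighborhood of [x] contains a tail of [y].  So sending
    [p] to the least [k] with the whole tail from [k] inside [U p] is
    well-defined and monotone.  It is cofinal since some [U p] avoids [y k]:
    its tail must start after [k]. *)
Lemma dominates_of_increasing_family le d (K : orderType d) (y : K -> X)
    d' (P : preorderType d') :
  GO_order le -> compact [set: X] -> well_order (<=%O : rel K) ->
  [set: K] !=set0 -> (forall k : K, exists j, k < j) ->
  (forall j k, j < k -> ~~ le (y k) (y j)) ->
  has_base_indexed_by X P -> dominates P K.
Proof.
move=> [le_lin rays convex] cptX woK K0 Knomax y_incr Pbase.
have [le_refl _ le_trans le_total] := le_lin.
have lt_wf := well_order_wf woK.
have y_mono := increasing_le le_lin y_incr.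
have [x xcl] := compact_cluster_of_family y cptX K0.
have y_lt k : ~~ le x (y k).
  apply/negP => xk; have [j kj] := Knomax k.
  have [|i ji] := xcl [set z | ~~ le (y j) z] _ j; last by rewrite /= y_mono.
  apply: open_nbhs_nbhs; split; first by case: (rays (y j)).
  by apply: contra (y_incr _ _ kj) => jx; apply: le_trans jx xk.
have [U [[Ux Ubase] U_anti]] := Pbase x.
have /choice[a aP] : forall p, exists k,
    (forall j, k <= j -> U p (y j)) /\
    forall i, (forall j, i <= j -> U p (y j)) -> k <= i.
  move=> p; have [|W [xW WU Wconvex]] := convex x (U p).
    by apply: Ux; exists p.
  have [k0 _] := K0; have [k _ Wk] := xcl W xW k0.
  have [|m Um m_le] :=
      @wf_least _ _ [set k | forall j, k <= j -> U p (y j)] lt_wf.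
    exists k => j kj; apply: WU; apply: (Wconvex (y k) x) => //.
    - exact: nbhs_singleton xW.
    - by case/orP: (le_total x (y k)) (y_lt k) => [->|].
    - by apply: contraNneq (y_lt k) => ->.
    - split; first exact: y_mono.
      by case/orP: (le_total x (y j)) (y_lt j) => [->|].
  by exists m; split=> // i Ui; rewrite leNgt; apply/negP => /(m_le i Ui).
exists a; split=> [p q pq|k].
  have [_ ap_le] := aP p; have [aqU _] := aP q; apply: ap_le => j aqj.
  by apply: U_anti pq _ _; exact: aqU.
have [|_ [p _ <-] Uk] := Ubase [set z | ~~ le z (y k)].
  by apply: open_nbhs_nbhs; split; [case: (rays (y k))|exact: y_lt].
exists p; rewrite leNgt; apply/negP => apk.
have [aU _] := aP p; have := Uk _ (aU k (ltW apk)).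
by rewrite /= le_refl.
Qed.

(** If all sets cofinal below the limit [x] have at least [K] elements, they
    leave room for an increasing family indexed by [K]; otherwise a smaller
    cofinal set, or a single neighborhood, generates the lower half. *)
Lemma dominates_or_small_lower_base le x d (K : orderType d)
    d' (P : preorderType d') :
  GO_order le -> compact [set: X] -> is_cardinal K -> infinite_set [set: K] ->
  (forall k : K, exists j, k < j) -> has_base_indexed_by X P ->
  dominates P K \/
  exists2 A : set_system X, lower_base le x A & ~ ([set: K] #<= A).
Proof.
move=> go cptX Kcard Kinf Knomax Pbase; have [[_ le_anti _ le_total] _ _] := go.
have [[N xN N_ge]|xlim] := isolated_or_limit_below le x.
  right; exists [set N]; first exact: lower_base_isolated.
  by move=> /card_le_finite KN; apply: Kinf; apply: KN; exact: finite_set1.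
have [[A Acof AK]|Kcof] := pselect (exists2 A,
    cofinal_in le (strictly_below le x) A & ~ ([set: K] #<= A)).
  right; exists [set [set z | ~~ le z a] | a in A].
    exact: lower_base_rays.
  by apply: contra_not AK => KA; apply: card_le_trans KA (card_image_le _ _).
left; have [l [_ lx]] := xlim _ filterT.
have [|||k|y [_ _ y_incr]] :=
  @increasing_transversal _ le (strictly_below le x) _ K (fun=> l) => //.
- by case: go.
- by move=> A Acof; apply: contrapT => KA; apply: Kcof; exists A.
apply: dominates_of_increasing_family go cptX _ _ Knomax y_incr Pbase.
- by case: Kcard.
- exact: infinite_setN0.
Qed.

Theorem dominates_cardinals_of_has_base d (P : preorderType d) :
  [set: P] !=set0 -> GO_space X -> compact [set: X] ->
  has_base_indexed_by X P -> dominates_cardinals_upto_character X P.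
Proof.
move=> [p0 _] /GO_spaceP[le go] cptX Pbase x dc chi [_ _ chi_le].
move=> dk K Kcard [k0 _] Kchi.
have [[m m_max]|nomax] := pselect (exists m : K, forall k, k <= m).
  by exists (fun=> m); split=> // k; exists p0.
have Knomax (k : K) : exists j, k < j.
  apply: contrapT => kmax; apply: nomax; exists k => j.
  by rewrite leNgt; apply/negP => kj; apply: kmax; exists j.
have Kinf : infinite_set [set: K].
  have /choice[s sP] := Knomax; pose it n := iter n s k0.
  have it_lt m n : (m < n)%N -> it m < it n.
    elim: n => // n IH; rewrite ltnS leq_eqVlt.
    by move=> /predU1P[->|/IH/lt_trans]; [|apply]; exact: sP.
  apply/infiniteP; apply: (@card_le_inj _ _ _ _ it) => // m n _ _ mn.
  by case: (ltngtP m n) => // /it_lt; rewrite mn ltxx.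
have small le' (go' : GO_order le') :=
  dominates_or_small_lower_base x go' cptX Kcard Kinf Knomax Pbase.
have [//|[A Abase KA]] := small _ go.
have [//|[C Cbase KC]] := small _ (GO_order_reversed go).
have ACbase := nbhs_base_of_sides go Abase Cbase.
have [||] := @card_setX_infinite _ _ _ [set: K] A C Kinf => //.
apply: card_le_trans Kchi (card_le_trans (chi_le _ ACbase) _).
exact: card_image_le.
Qed.

End PointwiseBases.

Theorem theorem7p2 (d : Order.disp_t) (P : preorderType d) (X : topologicalType) :
  [set: P] !=set0 -> poset_equiv P (P *p P) -> GO_space X ->
  (dominates_cardinals_upto_character X P -> has_base_indexed_by X P) /\
  (compact [set: X] -> has_base_indexed_by X P ->
     dominates_cardinals_upto_character X P).
Proof.
move=> P0 [PP _] goX; split.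
  exact: has_base_of_dominates_cardinals.
exact: dominates_cardinals_of_has_base.
Qed.
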